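(* Let $G$ be a split graph with vertex partition $I\cup C$, where $C$ is a clique, $I=\{a,b,c\}$ is an independent set, and no vertex of $I$ is adjacent to all vertices of $C$. For $S\subseteq I$, say that ''$C$ contains $v_S$'' if there is a vertex of $C$ whose set of neighbours in $I$ is exactly $S$. Then $G$ is not semi-transitive if and only if at least one of the following holds: (a) $C$ contains $v_\emptyset$, $v_{\{a,b\}}$, $v_{\{a,c\}}$, $v_{\{b,c\}}$; (b) $C$ contains $v_{\{a,b,c\}}$, $v_{\{a,b\}}$, $v_{\{a,c\}}$, $v_{\{b,c\}}$; (c) $C$ contains $v_{\{a,b,c\}}$, $v_{\{a\}}$, $v_{\{b\}}$, $v_{\{c\}}$. Equivalently, $G$ is not semi-transitive if and only if it contains as an induced subgraph one of the three split graphs with clique $\{1,2,3,4\}$ and independent set $\{a,b,c\}$ having edge sets (besides the clique edges): (a) $a1,a2,b1,b3,c2,c3$; (b) $a1,a2,a4,b1,b3,b4,c2,c3,c4$; (c) $a1,a4,b2,b4,c3,c4$.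
   Context: A directed graph is semi-transitive if it is acyclic and for every directed path $w_1\to w_2\to\cdots\to w_s$ with $s\ge 2$, either there is no edge from $w_1$ to $w_s$, or all edges $w_i\to w_j$ exist for $1\le i<j\le s$. An undirected graph is semi-transitive if it admits a semi-transitive orientation. A split graph is a graph whose vertex set can be partitioned into a clique $C$ and an independent set $I$. *)

(* Defs.v *)
From mathcomp Require Import all_boot.

Set Implicit Arguments.
Unset Strict Implicit.
Unset Printing Implicit Defensive.

Section SemiTransitivity.
Variable T : finType.
Implicit Types (d e : rel T) (I C S : {set T}).

Definition acyclic d : Prop := forall p : seq T, p != [::] -> ~~ cycle d p.

(* The directed path w_1 -> ... -> w_s is the sequence x :: p with x = w_1;
   pairwise d (x :: p) says that w_i -> w_j for all i < j. *)
Definition semi_transitive_digraph d : Prop :=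
  acyclic d /\
  forall (x : T) (p : seq T), p != [::] -> path d x p ->
    ~~ d x (last x p) \/ pairwise d (x :: p).

(* Every edge of e gets exactly one direction in d, and d has no other arc. *)
Definition orientation e d : Prop :=
  (forall x y, e x y = d x y || d y x) /\
  (forall x y, ~~ (d x y && d y x)).

Definition semi_transitive e : Prop :=
  exists d : rel T, orientation e d /\ semi_transitive_digraph d.

Definition split_partition e I C : Prop :=
  [/\ I :|: C = [set: T],
      [disjoint I & C],
      {in C &, forall x y, x != y -> e x y} &
      {in I &, forall x y, ~~ e x y}].

Definition contains_v e I C S : Prop :=
  exists2 v, v \in C & [set x in I | e v x] = S.

End SemiTransitivity.

Definition induced_subgraph (U T : finType) (h : rel U) (e : rel T) : Prop :=
  exists f : U -> T, injective f /\ forall x y, e (f x) (f y) = h x y.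

(* Split graph with clique {1,2,3,4} and independent set {a,b,c}: inl i is the
   clique vertex i + 1, and inr 0, inr 1, inr 2 are a, b, c. A pair (u, k) in E
   is the edge joining the independent vertex number u to the clique vertex
   labelled k (labels starting from 1). *)
Definition split43 (E : seq (nat * nat)) : rel ('I_4 + 'I_3) :=
  fun x y =>
    match x, y with
    | inl i, inl j => i != j
    | inl i, inr u => (val u, (val i).+1) \in E
    | inr u, inl i => (val u, (val i).+1) \in E
    | inr _, inr _ => false
    end.

Definition graph_a : rel ('I_4 + 'I_3) :=
  split43 (let: (a, b, c) := (0, 1, 2) in
           [:: (a, 1); (a, 2); (b, 1); (b, 3); (c, 2); (c, 3)]).

Definition graph_b : rel ('I_4 + 'I_3) :=
  split43 (let: (a, b, c) := (0, 1, 2) in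
           [:: (a, 1); (a, 2); (a, 4); (b, 1); (b, 3); (b, 4);
               (c, 2); (c, 3); (c, 4)]).

Definition graph_c : rel ('I_4 + 'I_3) :=
  split43 (let: (a, b, c) := (0, 1, 2) in
           [:: (a, 1); (a, 4); (b, 2); (b, 4); (c, 3); (c, 4)]).

(* Main.v *)
(** Semi-transitivity is hereditary, so it is enough to run the cycle
    "not semi-transitive => one of the three neighbourhood patterns => one of
    the three induced subgraphs => not semi-transitive".  The last step is a
    finite search: orienting the edges of each graph one at a time always
    produces a directed cycle or a shortcut with at most four vertices.  For
    the first step, a vertex of the clique matters only through its
    neighbourhood in I.  If no pattern occurs, the neighbourhoods that are
    present can be linearly ordered so that orienting all edges upwards is
    semi-transitive: when one of the three pairs is missing, the vertices
    adjacent to a, to b and to c can be made intervals, with a, b, c as sources;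
    when only the empty and the full neighbourhoods are missing, the cyclic
    order a, ab, b, bc, c, ac works, with a placed between ab and b. *)
Require Import Defs.
From mathcomp Require Import all_boot.

Set Implicit Arguments.
Unset Strict Implicit.
Unset Printing Implicit Defensive.

(** * Non-semi-transitivity by heredity and exhaustive search *)

Lemma semi_transitive_induced (U T : finType) (h : rel U) (e : rel T) :
  induced_subgraph h e -> semi_transitive e -> semi_transitive h.
Proof.
move=> [f [_ fE]] [d [[ed dd] [acy sc]]]; exists (relpre f d); split.
  by split=> [x y|x y] /=; rewrite -?fE ?ed.
split=> [[//|x p] _|x p p0 dp].
  by have := acy (map f (x :: p)) isT; rewrite /= -map_rcons path_map.
have := sc (f x) (map f p); rewrite last_map -map_cons pairwise_map.
by apply; [case: (p) p0 | rewrite path_map].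
Qed.

Section Refutation.
Variables (U : finType) (h : rel U).
Implicit Types arcs es : seq (U * U).

(** Adjacency of all pairs is tested in [h], not in [arcs]: a non-edge of [h] spoils the walk
    however the remaining edges get oriented. *)
Definition forbidden arcs (w : seq U) : bool :=
  if w is x :: p then
    ((last x p, x) \in arcs) && path (fun u v => (u, v) \in arcs) x p ||
    [&& (x, last x p) \in arcs, ~~ pairwise h w &
        path (fun u v => (u, v) \in arcs) x p]
  else false.

(* No property of walks is used: forbidden rechecks every candidate. *)
Fixpoint walks n arcs : seq (seq U) :=
  if n is n'.+1 then
    let ws := walks n' arcs in
    [seq [:: p.1; p.2] | p <- arcs] ++
    [seq p.1 :: w | w <- ws, p <- [seq p <- arcs | ohead w == Some p.2]]
  else [::].

(* Conditionals instead of && and ||, whose second argument vm_compute would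
   always evaluate, so that refuted branches are pruned. *)
Fixpoint refute n es arcs : bool :=
  if has (forbidden arcs) (walks n arcs) then true else
  if es is (u, v) :: es' then
    if refute n es' ((u, v) :: arcs) then refute n es' ((v, u) :: arcs)
    else false
  else false.

(** The branch that orients every edge as [d] does never meets a forbidden walk, so it runs out of
    edges unrefuted. *)
Lemma refute_orientation (d : rel U) n es arcs :
  orientation h d -> semi_transitive_digraph d ->
  all (fun p => h p.1 p.2) es -> all (fun p => d p.1 p.2) arcs ->
  ~~ refute n es arcs.
Proof.
move=> [hd dd] [acy sc].
have ok ar : all (fun p => d p.1 p.2) ar -> ~~ has (forbidden ar) (walks n ar).
  move=> /allP dar; apply/hasPn => -[//|x p] _; rewrite /forbidden.
  have dP : path (fun u v => (u, v) \in ar) x p -> path d x p.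
    by apply: sub_path => u v /dar.
  rewrite negb_or; apply/andP; split; apply/negP.
    case/andP=> /dar /= dl /dP dp.
    by have := acy (x :: p) isT; rewrite /= rcons_path dp dl.
  case/and3P=> /dar /= dl nh /dP dp.
  have p0 : p != [::].
    by case: (p) dl => //= dxx; have := dd x x; rewrite dxx.
  have [|pw] := sc x p p0 dp; first by rewrite dl.
  move/negP: nh; apply; apply: (sub_pairwise _ pw) => u v duv.
  by rewrite hd duv.
elim: es arcs => [|[u v] es IH] arcs /= hes dar; rewrite (negbTE (ok _ dar)) //.
case/andP: hes => huv hes; rewrite -/(_ && _) negb_and.
by move: huv; rewrite hd => /orP[dxy|dyx];
  apply/orP; [left|right]; apply: IH; rewrite //= ?dxy ?dyx.
Qed.

Lemma refute_semi_transitive n es :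
  all (fun p => h p.1 p.2) es -> refute n es [::] -> ~ semi_transitive h.
Proof.
move=> hes r [d [od sd]].
by have := refute_orientation n od sd hes (isT : all _ [::]); rewrite r.
Qed.

End Refutation.

Definition vertices43 : seq ('I_4 + 'I_3) :=
  [:: inl (Ordinal (isT : 0 < 4)); inl (Ordinal (isT : 1 < 4));
      inl (Ordinal (isT : 2 < 4)); inl (Ordinal (isT : 3 < 4));
      inr (Ordinal (isT : 0 < 3)); inr (Ordinal (isT : 1 < 3));
      inr (Ordinal (isT : 2 < 3))].

(** Edges come by larger endpoint, so the clique is oriented first and excluding cycles leaves only
    its 24 linear orders. *)
Definition edges43 (h : rel ('I_4 + 'I_3)) :=
  [seq p <- [seq (nth (inr ord0) vertices43 i, nth (inr ord0) vertices43 j)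
            | j <- iota 0 7, i <- iota 0 j] | h p.1 p.2].

Lemma edges43P h : all (fun p => h p.1 p.2) (edges43 h).
Proof. exact: filter_all. Qed.

Lemma graph_a_not_semi_transitive : ~ semi_transitive graph_a.
Proof.
by apply: (refute_semi_transitive (n := 3) (edges43P _)); vm_compute.
Qed.

Lemma graph_b_not_semi_transitive : ~ semi_transitive graph_b.
Proof.
by apply: (refute_semi_transitive (n := 3) (edges43P _)); vm_compute.
Qed.

Lemma graph_c_not_semi_transitive : ~ semi_transitive graph_c.
Proof.
by apply: (refute_semi_transitive (n := 3) (edges43P _)); vm_compute.
Qed.

(** * Semi-transitivity from a numbering of the vertices *)

(* On a path w_1 -> ... -> w_s with w_1 -> w_s, the first condition propagates
   the adjacency to w_s from w_i to w_(i+1); then, as w_2 ... w_s is a shortcut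
   path in its own right, the second one makes w_1 adjacent to every w_i. *)
Lemma semi_transitive_of_key (T : finType) (e : rel T) (key : T -> nat) :
  symmetric e -> (forall x y, e x y -> key x != key y) ->
  let d x y := e x y && (key x < key y) in
  (forall x w z y, d x w -> d w z -> d x y -> key z <= key y -> e w y) ->
  (forall x w z y, d x w -> d w z -> d z y -> d x y -> e x z) ->
  semi_transitive e.
Proof.
move=> e_sym e_key d H1 H2; exists d.
have d_lt x y : d x y -> key x < key y by case/andP.
have sorted_key x p : path d x p -> path ltn (key x) (map key p).
  by rewrite path_map; apply: sub_path => u v /d_lt.
have lt_all x p : path d x p -> {in p, forall z, key x < key z}.
  move=> /sorted_key /(order_path_min ltn_trans) /allP lt z zp.
  exact/lt/map_f.
have le_last x p : path d x p -> {in x :: p, forall z, key z <= key (last x p)}.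
  elim: p x => [|y p IH] x /=; first by move=> _ z; rewrite inE => /eqP->.
  move=> /andP[dxy dp] z; rewrite inE => /predU1P[->|/IH->//].
  by apply: leq_trans (ltnW (d_lt _ _ dxy)) _; rewrite (IH y) ?mem_head.
split.
  split=> x y; last by rewrite /d; case: ltngtP; rewrite ?andbF.
  rewrite /d [e y x]e_sym -andb_orr; case: (boolP (e x y)) => //= /e_key.
  by rewrite neq_ltn => ->.
split=> [[//|x p] _|x p p0].
  by apply/negP => /= /lt_all /(_ x); rewrite mem_rcons mem_head ltnn => /(_ isT).
case: (boolP (d x (last x p))) => [dxl dp|]; [right | by left].
elim: p x {p0} dxl dp => [//|w p IH] x dxl dp.
have /andP[dxw dwp] := dp.
have dwl : p != [::] -> d w (last w p).
  case: p dxl dp dwp {IH} => // z p dxl dp dwp _.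
  have zl : key z <= key (last w (z :: p)).
    by apply: (le_last w (z :: p)); rewrite // !inE eqxx orbT.
  have /andP[dwz _] := dwp.
  rewrite /d (H1 _ _ _ _ dxw dwz dxl zl).
  by apply: leq_trans zl; apply: d_lt.
have pw : pairwise d (w :: p).
  by case: (p) dwl dwp IH => // z p' dwl dwp IH; apply: IH; rewrite ?dwl.
rewrite pairwise_cons pw andbT /= dxw /=; apply/allP => z zp.
have dxz := lt_all _ _ dp z (mem_behead (s := w :: p) zp).
rewrite /d dxz andbT.
have dwz : d w z by move: pw; rewrite pairwise_cons => /andP[/allP/(_ z zp)].
have [zl|zl] := eqVneq z (last w p).
  by move: dxl; rewrite /= -zl => /andP[].
have dzl : d z (last w p).
  case/splitPr: zp pw zl {dxz dwz dxl dp dwp dwl IH} => p1 p2.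
  rewrite last_cat last_cons; case/lastP: p2 => [|p2 y]; first by rewrite /= eqxx.
  rewrite last_rcons pairwise_cons pairwise_cat => /and4P[_ _ _].
  by rewrite pairwise_cons all_rcons => /andP[/andP[]].
exact: H2 dxw dwz dzl dxl.
Qed.

(** * Neighbourhood kinds and orders on them *)

(* inl i is the i-th vertex of I; inr s is a clique vertex, s telling which
   vertices of I are its neighbours. *)
Definition kind : Type := (nat + seq bool)%type.

(** Equal clique kinds count as adjacent: they may come from distinct clique vertices with the same
    neighbours in I. *)
Definition adj (k k' : kind) : bool :=
  match k, k' with
  | inl _, inl _ => false
  | inl i, inr s | inr s, inl i => nth false s i
  | inr _, inr _ => true
  end.

(* The two conditions of semi_transitive_of_key, with weak inequalities between
   kinds because distinct clique vertices may have the same kind. *)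
Definition good_order (l : seq kind) : bool :=
  let le k k' := index k l <= index k' l in
  all (fun x => all (fun w => all (fun z => all (fun y =>
    [&& adj x w, adj w z, adj x y, le x w, le w z & le z y] ==>
    adj w y && (adj z y ==> adj x z)) l) l) l) l.

Definition bits (s : seq nat) : seq bool := [seq i \in s | i <- iota 0 3].

(* Orders for graphs without v_{p,q}, when moreover v_{p,q,r}, v_{r} or v_{p}
   respectively is missing. *)
Definition interval_orders (t : nat * nat * nat) : seq (seq kind) :=
  let: (p, q, r) := t in
  [seq [:: inl 0, inl 1, inl 2 & [seq inr (bits s) | s <- o]] | o <-
   [:: [:: [:: p]; [:: p; r]; [:: r]; [:: q; r]; [:: q]; [::]];
       [:: [:: p]; [:: p; r]; [:: p; q; r]; [:: q; r]; [:: q]; [::]];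
       [:: [:: r]; [:: p; r]; [:: p; q; r]; [:: q; r]; [:: q]; [::]]]].

(** The clique neighbours of vertex 0 form an initial and a final block instead of an interval;
    placed after the first block, vertex 0 receives arcs from it and sends arcs to the last. *)
Definition wrapped_order : seq kind :=
  [:: inl 1; inl 2; inr (bits [:: 0]); inr (bits [:: 0; 1]); inl 0;
      inr (bits [:: 1]); inr (bits [:: 1; 2]); inr (bits [:: 2]);
      inr (bits [:: 0; 2])].

Definition orders : seq (seq kind) :=
  wrapped_order :: flatten (map interval_orders
    [:: (0, 1, 2); (1, 0, 2); (0, 2, 1); (2, 0, 1); (1, 2, 0); (2, 1, 0)]).

Lemma good_orders : all good_order orders.
Proof. by vm_compute. Qed.

Definition obstructions : seq (seq (seq nat)) :=
  [:: [:: [::]; [:: 0; 1]; [:: 0; 2]; [:: 1; 2]];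
      [:: [:: 0; 1; 2]; [:: 0; 1]; [:: 0; 2]; [:: 1; 2]];
      [:: [:: 0; 1; 2]; [:: 0]; [:: 1]; [:: 2]]].

Definition all_bits : seq (seq bool) :=
  [seq x :: s | x <- [:: false; true],
     s <- [seq [:: y; z] | y <- [:: false; true], z <- [:: false; true]]].

Lemma mem_all_bits s : size s = 3 -> s \in all_bits.
Proof. by case: s => [|[] [|[] [|[] [|]]]]. Qed.

Fixpoint sublists (X : Type) (s : seq X) : seq (seq X) :=
  if s is x :: s' then
    let ss := sublists s' in ss ++ [seq x :: r | r <- ss]
  else [:: [::]].

Lemma filter_sublists (X : eqType) (P : pred X) (s : seq X) :
  filter P s \in sublists s.
Proof.
elim: s => //= x s IH; rewrite mem_cat; case: (P x); rewrite ?IH //.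
by rewrite map_f ?orbT.
Qed.

(** Only the subset of the eight bit vectors selected by [P] matters, so checking the 256 sublists
    of [all_bits] settles every case. *)
Lemma obstruction_or_order (P : pred (seq bool)) :
  has (all (fun s => P (bits s))) obstructions \/
  exists2 l, l \in orders & {in all_bits, forall s, P s -> inr s \in l}.
Proof.
have /allP/(_ _ (filter_sublists P all_bits)) : all (fun A =>
    has (all (fun s => bits s \in A)) obstructions ||
    has (fun l => all (fun s => (inr s : kind) \in l) A) orders)
  (sublists all_bits) by vm_compute.
case/orP=> [/hasP[o oO /allP oA]|/hasP[l lO /allP lA]]; [left|right].
  by apply/hasP; exists o => //; apply/allP => s /oA; rewrite mem_filter => /andP[].
by exists l => // s sA Ps; apply: lA; rewrite mem_filter Ps.
Qed.

(** * Split graphs with three independent vertices *)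

Section SplitThree.
Variables (T : finType) (e : rel T) (I C : {set T}) (t : seq T).
Hypotheses (e_sym : symmetric e) (e_irr : irreflexive e).
Hypotheses (t_uniq : uniq t) (t_size : size t = 3) (I_t : I =i t).
Hypothesis IC_split : split_partition e I C.

Definition nbits (v : T) : seq bool := [seq e v y | y <- t].

Definition present (s : seq bool) : bool := [exists v in C, nbits v == s].

Definition kind_of (x : T) : kind :=
  if x \in C then inr (nbits x) else inl (index x t).

Lemma not_clique x : x \notin C -> x \in t.
Proof.
case: IC_split => /setP/(_ x) IC _ _ _ /negbTE xC.
by move: IC; rewrite !inE xC orbF I_t.
Qed.

Lemma clique_not_indep x : x \in C -> x \notin t.
Proof.
case: IC_split => _ /pred0P/(_ x) /= IC _ _ xC.
by move: IC; rewrite xC andbT I_t => ->.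
Qed.

Lemma adj_kind x y : x != y -> e x y = adj (kind_of x) (kind_of y).
Proof.
have eqn u v : v \in t -> nth false (nbits u) (index v t) = e u v.
  by move=> vt; rewrite (nth_map v) ?index_mem // nth_index.
case: IC_split => _ _ CC II xy; rewrite /kind_of.
case: ifPn => xC; case: ifPn => yC /=.
- exact: CC.
- by rewrite eqn ?not_clique.
- by rewrite eqn ?not_clique.
- by apply/negbTE/II; rewrite I_t not_clique.
Qed.

Lemma semi_transitive_of_order (l : seq kind) :
  good_order l -> {in C, forall v, inr (nbits v) \in l} ->
  {in iota 0 3, forall i, inl i \in l} -> semi_transitive e.
Proof.
move=> l_good lC lI.
have l_kind x : kind_of x \in l.
  rewrite /kind_of; case: ifPn => [/lC //|/not_clique xt].
  by apply: lI; rewrite mem_iota /= -t_size index_mem.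
(* Kinds are compared first; as [enum_rank x] is below [#|T|], it only breaks ties inside a kind and
   makes [key] injective. *)
pose key x := index (kind_of x) l * #|T| + enum_rank x.
have key_inj : injective key.
  move=> x y /(congr1 (modn^~ #|T|)); rewrite !modnMDl !modn_small //.
  by move/val_inj/enum_rank_inj.
have key_le x y : key x <= key y -> index (kind_of x) l <= index (kind_of y) l.
  move/(leq_div2r #|T|); have T0 : 0 < #|T| by apply/card_gt0P; exists x.
  by rewrite !divnMDl // !divn_small // !addn0.
have e_key x y : e x y -> key x != key y.
  by apply: contraTneq => /key_inj->; rewrite e_irr.
have good x w z y : e x w -> e w z -> e x y ->
    key x < key w -> key w < key z -> key z <= key y ->
    e w y /\ (e z y -> e x z).
  have adjE u v : key u < key v -> adj (kind_of u) (kind_of v) = e u v.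
    by move=> uv; rewrite adj_kind //; apply: contraTneq uv => ->; rewrite ltnn.
  move=> exw ewz exy xw wz zy.
  have xz := ltn_trans xw wz; have wy := leq_trans wz zy.
  have xy := ltn_trans xw wy.
  move: l_good => /allP/(_ _ (l_kind x))/allP/(_ _ (l_kind w)).
  move=> /allP/(_ _ (l_kind z))/allP/(_ _ (l_kind y)).
  rewrite !(adjE x) ?(adjE w) // exw ewz exy !key_le ?(ltnW xw) ?(ltnW wz) //=.
  case/andP=> -> /implyP zyxz; split=> // ezy; apply: zyxz.
  (* Here [z] and [y] could coincide, since [zy] is a weak inequality; the edge [ezy] separates
     them. *)
  by rewrite -adj_kind //; apply: contraTneq ezy => ->; rewrite e_irr.
apply: (semi_transitive_of_key e_sym e_key) => x w z y.
  move=> /andP[exw xw] /andP[ewz wz] /andP[exy _] zy.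
  by case: (good x w z y).
move=> /andP[exw xw] /andP[ewz wz] /andP[ezy zy] /andP[exy _].
by case: (good x w z y) => // [|_]; [exact: ltnW|apply].
Qed.

Lemma present_obstruction :
  ~ semi_transitive e -> has (all (fun s => present (bits s))) obstructions.
Proof.
move=> nst; case: (obstruction_or_order present) => // -[l lO lP]; case: nst.
apply: (semi_transitive_of_order (allP good_orders l lO)).
  move=> v vC; apply: lP; first by rewrite mem_all_bits // size_map.
  by apply/exists_inP; exists v.
by apply/allP; move: l lO {lP}; apply/allP.
Qed.

Lemma contains_vP (S : {set T}) : S \subset I ->
  contains_v e I C S <-> present [seq x \in S | x <- t].
Proof.
move=> /subsetP SI; split=> [[v vC vS]|/exists_inP[v vC /eqP/eq_in_map vS]].
  apply/exists_inP; exists v => //; apply/eqP/eq_in_map => x xt.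
  by rewrite -vS inE I_t xt.
exists v => //; apply/setP => x; rewrite inE.
case: (boolP (x \in t)) => xt; first by rewrite I_t xt vS.
rewrite I_t (negbTE xt); apply/esym/negbTE.
by apply: contra xt => /SI; rewrite I_t.
Qed.

Definition row (E : seq (nat * nat)) (k : nat) : seq bool :=
  [seq (u, k.+1) \in E | u <- iota 0 3].

(** Any clique vertices realising the rows will do: distinct rows force distinct vertices, and [t]
    supplies the independent ones in order. *)
Lemma induced_split43 (E : seq (nat * nat)) :
  uniq [seq row E k | k <- iota 0 4] -> all present [seq row E k | k <- iota 0 4] ->
  induced_subgraph (split43 E) e.
Proof.
move=> rows_uniq /allP rows_present.
have row_present (i : 'I_4) : present (row E i).
  by apply/rows_present/map_f; rewrite mem_iota ltn_ord.
pose g i := xchoose (existsP (row_present i)).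
have gP i : (g i \in C) && (nbits (g i) == row E i).
  exact: (xchooseP (existsP (row_present i))).
have gC i : g i \in C by case/andP: (gP i).
have gE i : nbits (g i) = row E i by case/andP: (gP i) => _ /eqP.
have g_inj : injective g.
  move=> i j /(congr1 nbits); rewrite !gE => ij; apply/val_inj/eqP.
  have nthr (k : 'I_4) : nth [::] [seq row E k | k <- iota 0 4] k = row E k.
    by rewrite (nth_map 0) ?size_iota // nth_iota.
  by rewrite -(nth_uniq [::] _ _ rows_uniq) ?size_map ?size_iota ?ltn_ord //
    !nthr ij.
(* The default [g ord0] is never reached, as [u] is below [size t]. *)
pose h (u : 'I_3) := nth (g ord0) t u.
have ht u : h u \in t by rewrite mem_nth // t_size.
have hI u : h u \in I by rewrite I_t.
have gh i u : e (g i) (h u) = ((val u, (val i).+1) \in E).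
  have := congr1 (nth false ^~ u) (gE i).
  by rewrite (nth_map (g ord0)) ?t_size // (nth_map 0) ?size_iota // nth_iota.
have gnh i u : g i != h u.
  by apply: contraTneq (clique_not_indep (gC i)) => ->; rewrite negbK.
case: IC_split => _ _ CC II.
exists (fun x => match x with inl i => g i | inr u => h u end); split.
  move=> [i|u] [j|w].
  - by move/g_inj->.
  - by move/eqP; rewrite (negbTE (gnh _ _)).
  - by move/eqP; rewrite eq_sym (negbTE (gnh _ _)).
  - move/eqP; rewrite nth_uniq ?t_size // => /eqP/val_inj->//.
move=> [i|u] [j|w] /=; rewrite ?gh //.
- have [->|ij] := eqVneq i j; first by rewrite e_irr.
  by apply: CC; rewrite ?(inj_eq g_inj).
- by rewrite e_sym gh.
- exact/negbTE/II.
Qed.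

End SplitThree.

Theorem theorem5 (T : finType) (e : rel T)
    (e_sym : symmetric e) (e_irr : irreflexive e)
    (I C : {set T}) (a b c : T)
    (abc_uniq : uniq [:: a; b; c])
    (I_abc : I = [set a; b; c])
    (IC_split : split_partition e I C)
    (I_not_full : {in I, forall x, ~ {in C, forall y, e x y}}) :
  (~ semi_transitive e <->
    [\/ [/\ contains_v e I C set0, contains_v e I C [set a; b],
            contains_v e I C [set a; c] & contains_v e I C [set b; c]],
        [/\ contains_v e I C [set a; b; c], contains_v e I C [set a; b],
            contains_v e I C [set a; c] & contains_v e I C [set b; c]] |
        [/\ contains_v e I C [set a; b; c], contains_v e I C [set a],
            contains_v e I C [set b] & contains_v e I C [set c]]]) /\
  (~ semi_transitive e <->
    [\/ induced_subgraph graph_a e,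
        induced_subgraph graph_b e |
        induced_subgraph graph_c e]).
Proof.
set t := [:: a; b; c] in abc_uniq.
have t_size : size t = 3 by [].
have I_t : I =i t by move=> x; rewrite I_abc !inE orbA.
have [ab ac bc] : [/\ a != b, a != c & b != c].
  by move: abc_uniq; rewrite /= !inE negb_or andbT => /andP[/andP[-> ->] ->].
have cvP (s : seq nat) :
    contains_v e I C [set x in mask (bits s) t] <-> present e C t (bits s).
  have s_bits : bits s = [seq x \in [set x in mask (bits s) t] | x <- t].
    rewrite /bits /=; case: (0 \in s); case: (1 \in s); case: (2 \in s);
    by rewrite /= !inE ?eqxx ?[b == a]eq_sym ?[c == a]eq_sym ?[c == b]eq_sym
               ?(negbTE ab) ?(negbTE ac) ?(negbTE bc).
  rewrite {2}s_bits; apply: contains_vP => //.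
  by apply/subsetP => x; rewrite inE I_t => /mem_mask.
have S0 : set0 = [set x in mask (bits [::]) t] by apply/setP=> x; rewrite !inE.
have Sa : [set a] = [set x in mask (bits [:: 0]) t].
  by apply/setP=> x; rewrite !inE.
have Sb : [set b] = [set x in mask (bits [:: 1]) t].
  by apply/setP=> x; rewrite !inE.
have Sc : [set c] = [set x in mask (bits [:: 2]) t].
  by apply/setP=> x; rewrite !inE.
have Sab : [set a; b] = [set x in mask (bits [:: 0; 1]) t].
  by apply/setP=> x; rewrite !inE.
have Sac : [set a; c] = [set x in mask (bits [:: 0; 2]) t].
  by apply/setP=> x; rewrite !inE.
have Sbc : [set b; c] = [set x in mask (bits [:: 1; 2]) t].
  by apply/setP=> x; rewrite !inE.
have Sabc : [set a; b; c] = [set x in mask (bits [:: 0; 1; 2]) t].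
  by apply/setP=> x; rewrite !inE orbA.
set contains := [\/ _, _ | _]; set induced := [\/ _, _ | _].
have nst_contains : ~ semi_transitive e -> contains.
  move=> /(present_obstruction e_sym e_irr t_size I_t IC_split).
  rewrite /= orbF !andbT /contains S0 Sabc Sab Sac Sbc Sa Sb Sc.
  by case/or3P=> /and4P[p1 p2 p3 p4];
    [apply: Or31 | apply: Or32 | apply: Or33]; split; apply/cvP.
have contains_induced : contains -> induced.
  pose emb := induced_split43 e_sym e_irr abc_uniq t_size I_t IC_split.
  rewrite /contains S0 Sabc Sab Sac Sbc Sa Sb Sc.
  (* The first set of each pattern is the row of clique vertex 4, the others those of 1, 2, 3; rows
     and [bits] agree by computation. *)
  by case=> -[/cvP p1 /cvP p2 /cvP p3 /cvP p4];
    [apply: Or31 | apply: Or32 | apply: Or33]; apply: emb => //;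
    apply/and5P; split.
have induced_nst : induced -> ~ semi_transitive e.
  case=> /semi_transitive_induced ind /ind.
  - exact: graph_a_not_semi_transitive.
  - exact: graph_b_not_semi_transitive.
  - exact: graph_c_not_semi_transitive.
by split; split; auto.
Qed.
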